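(* For the $T^2$-action on the nearly Kähler six-sphere with multi-moment map $\nu_{\mathbb{S}^6}$ described in the context, the orbit space $\nu_{\mathbb{S}^6}^{-1}(0)/T^2$ can be identified with (i.e. is homeomorphic to) $\mathbb{S}^3/\mathbb{Z}_2^2$.
   Context: On $\mathbb{R}^7$ with coordinates $x^1,\dots,x^7$, standard inner product and standard dual basis $e^1,\dots,e^7$, let $\varphi = e^{123}+e^{145}+e^{167}+e^{246}-e^{257}-e^{347}-e^{356}$, where $e^{ijk}=e^i\wedge e^j\wedge e^k$. The cross product $P$ is defined by $\langle P(X,Y),Z\rangle=\varphi(X,Y,Z)$. On $\mathbb{S}^6\subset\mathbb{R}^7$ with round metric $g$ and unit normal $N$ put $JX = P(N,X)$, $\sigma = g(J\cdot,\cdot)$, $\psi_+=\iota^*\varphi$, $\psi_-=-\iota^*(N\lrcorner{*}\varphi)$, where $\iota:\mathbb{S}^6\hookrightarrow\mathbb{R}^7$ is the inclusion and $*$ is the Hodge star operator on $\mathbb{R}^7$ determined by the inner product and orientation induced by $\varphi$; this is a nearly Kähler structure ($d\sigma=3\psi_+$, $d\psi_-=-2\sigma\wedge\sigma$). Identify $\mathbb{R}^7\cong\mathbb{C}^3\oplus\mathbb{R}$ by $z^1=x^1+ix^6$, $z^2=x^5+ix^2$, $z^3=x^4+ix^3$, $t=x^7$. The torus $T^2$ of matrices $\mathrm{diag}(e^{i\vartheta},e^{i\phi},e^{-i(\vartheta+\phi)})$ in $\mathrm{SU}(3)$ acts on $\mathbb{S}^6$ by $(z^1,z^2,z^3,t)\mapsto(e^{i\vartheta}z^1,e^{i\phi}z^2,e^{-i(\vartheta+\phi)}z^3,t)$,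 preserving the structure. Let $U,V$ be the vector fields generated by $\vartheta$ and $\phi$ respectively. The multi-moment map is $\nu_{\mathbb{S}^6}=\sigma(U,V)$, which equals $3\,\mathrm{Re}(z^1z^2z^3)$. $\mathbb{Z}_2^2$ denotes the real part of $T^2$, i.e. the group of diagonal matrices $\mathrm{diag}(\varepsilon_1,\varepsilon_2,\varepsilon_1\varepsilon_2)$ with $\varepsilon_1,\varepsilon_2\in\{\pm1\}$. It acts on $\mathbb{S}^3=\{(y_1,y_2,y_3,t)\in\mathbb{R}^4: t^2+\sum_i y_i^2=1\}$ by $(y_1,y_2,y_3,t)\mapsto(\varepsilon_1y_1,\varepsilon_2y_2,\varepsilon_1\varepsilon_2y_3,t)$. *)

(* Defs.v *)
From HB Require Import structures.
From mathcomp Require Import all_boot all_order all_algebra.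
From mathcomp Require Import generic_quotient.
From mathcomp Require Import all_classical all_reals all_analysis.
From mathcomp Require Import complex ring.

Set Implicit Arguments.
Unset Strict Implicit.
Unset Printing Implicit Defensive.

Import Order.TTheory GRing.Theory Num.Theory.
Import numFieldNormedType.Exports.

Local Open Scope classical_set_scope.
Local Open Scope ring_scope.
Local Open Scope quotient_scope.

Definition homeomorphic (X Y : topologicalType) : Prop :=
  exists (f : X -> Y) (g : Y -> X),
    [/\ cancel f g, cancel g f, continuous f & continuous g].

(* The group is a set [G] of elements of [M], acting on the ambient type [T];
   [A] is the subset of [T] whose points are being identified. *)
Definition orbit_rel (M : Type) (T : choiceType) (act : M -> T -> T)
    (G : set M) (A : set T) : rel A :=
  fun p q => `[< exists2 g, G g & act g (\val p) = \val q >].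
Arguments orbit_rel {M T} act G A _ _.

Lemma orbit_rel_equiv (K : pzRingType) (n : nat) (T : choiceType)
    (act : 'M[K]_n -> T -> T) (G : set 'M[K]_n) (A : set T) :
  (forall x, act 1%:M x = x) ->
  (forall g h x, act (g *m h) x = act g (act h x)) ->
  G 1%:M ->
  (forall g h, G g -> G h -> G (g *m h)) ->
  (forall g, G g -> exists2 h, G h & h *m g = 1%:M) ->
  equiv_class_of (orbit_rel act G A).
Proof.
move=> act1 actM G1 GM GV.
have sym p q : orbit_rel act G A p q -> orbit_rel act G A q p.
  move=> /asboolP[g Gg gpq]; apply/asboolP.
  by have [h Gh hg1] := GV g Gg; exists h; rewrite // -gpq -actM hg1 act1.
split.
- by move=> p; apply/asboolP; exists 1%:M; rewrite ?act1.
- by move=> p q; apply/idP/idP; exact: sym.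
- move=> q p r /asboolP[g Gg gpq] /asboolP[h Gh hqr]; apply/asboolP.
  by exists (h *m g); [exact: GM|rewrite actM gpq].
Qed.

Definition diag3 (K : pzRingType) (a b c : K) : 'M[K]_3 :=
  diag_mx (\row_(k < 3) [:: a; b; c]`_k).

Lemma diag3M (K : pzRingType) (a b c a' b' c' : K) :
  diag3 a b c *m diag3 a' b' c' = diag3 (a * a') (b * b') (c * c').
Proof.
rewrite /diag3 mulmx_diag; congr diag_mx; apply/rowP => -[[|[|[|k]]] lk3] //.
all: by rewrite !mxE.
Qed.

Lemma diag3_1 (K : pzRingType) : diag3 1 1 1 = 1%:M :> 'M[K]_3.
Proof. by apply/matrixP => -[[|[|[|i]]] ?] [[|[|[|j]]] ?]; rewrite !mxE. Qed.

Section R7.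
Context {R : realType}.
Implicit Types X Y Z p : 'rV[R]_7.

Definition dot (n : nat) (X Y : 'rV[R]_n) : R := \sum_k X 0 k * Y 0 k.

(* [xcoord i] is the coordinate written x^i on paper: indices run from 1 to 7. *)
Definition xcoord (i : nat) X : R := X 0 (inord i.-1).

(* e^i /\ e^j /\ e^k evaluated on (X, Y, Z), without any 1/3! factor. *)
Definition e3 (i j k : nat) X Y Z : R :=
  \det (\matrix_(a < 3, b < 3)
    xcoord (nth 0%N [:: i; j; k] b) (nth 0 [:: X; Y; Z] a)).

Definition varphi X Y Z : R :=
  e3 1 2 3 X Y Z + e3 1 4 5 X Y Z + e3 1 6 7 X Y Z + e3 2 4 6 X Y Z
  - e3 2 5 7 X Y Z - e3 3 4 7 X Y Z - e3 3 5 6 X Y Z.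

(* The coordinates are forced by <P(X,Y), Z> = varphi(X,Y,Z), see [crossP]. *)
Definition cross X Y : 'rV[R]_7 := \row_k varphi X Y (delta_mx 0 k).

Definition unit_sphere (n : nat) : set 'rV[R]_n := [set p | dot p p = 1].

(* At p in S^6 the (outward) unit normal is p itself. *)
Definition unit_normal p : 'rV[R]_7 := p.

Definition J_S6 p X : 'rV[R]_7 := cross (unit_normal p) X.

Definition sigma_S6 p X Y : R := dot (J_S6 p X) Y.

Definition zcoord p : 'cV[R[i]]_3 :=
  \col_(k < 3) [:: Complex (xcoord 1 p) (xcoord 6 p);
                   Complex (xcoord 5 p) (xcoord 2 p);
                   Complex (xcoord 4 p) (xcoord 3 p)]`_k.

Definition tcoord p : R := xcoord 7 p.

Definition of_zt (z : 'cV[R[i]]_3) (t : R) : 'rV[R]_7 :=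
  let z1 := z (inord 0) 0 in let z2 := z (inord 1) 0 in
  let z3 := z (inord 2) 0 in
  \row_(k < 7) [:: complex.Re z1; complex.Im z2; complex.Im z3;
                   complex.Re z3; complex.Re z2; complex.Im z1; t]`_k.

Definition act7 (A : 'M[R[i]]_3) p : 'rV[R]_7 :=
  of_zt (A *m zcoord p) (tcoord p).

Definition expi (s : R) : R[i] := Complex (cos s) (sin s).

Definition torus_mx (theta phi : R) : 'M[R[i]]_3 :=
  diag3 (expi theta) (expi phi) (expi (- (theta + phi))).

Definition T2 : set 'M[R[i]]_3 :=
  [set A | exists theta phi, A = torus_mx theta phi].

Definition gen_U p : 'rV[R]_7 := derive1 (fun s : R => act7 (torus_mx s 0) p) 0.
Definition gen_V p : 'rV[R]_7 := derive1 (fun s : R => act7 (torus_mx 0 s) p) 0.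

Definition nu_S6 p : R := sigma_S6 p (gen_U p) (gen_V p).

Definition nu_S6_zero : set 'rV[R]_7 := @unit_sphere 7 `&` [set p | nu_S6 p = 0].

Definition Z22 : set 'M[R]_3 :=
  [set E | exists eps1 eps2 : R,
     [/\ eps1 \in [:: 1; -1], eps2 \in [:: 1; -1] &
         E = diag3 eps1 eps2 (eps1 * eps2)]].

(* R^4 is R^3 (+) R with coordinates (y_1, y_2, y_3, t). *)
Definition act4 (E : 'M[R]_3) (v : 'rV[R]_4) : 'rV[R]_4 :=
  let v' : 'rV[R]_(3 + 1) := v in
  row_mx (E *m (lsubmx v')^T)^T (rsubmx v').

End R7.
Arguments unit_sphere : clear implicits.
Arguments nu_S6_zero : clear implicits.

Section cross_product.
Context {R : realType}.
Implicit Types X Y Z p : 'rV[R]_7.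

Let e3Z i j k (X Y : 'rV[R]_7) : forall a Z Z',
  e3 i j k X Y (a *: Z + Z') = a * e3 i j k X Y Z + e3 i j k X Y Z'.
Proof.
move=> a Z Z'; rewrite -[X in _ = _ + X]mul1r.
apply: (determinant_multilinear (i0 := (inord 2 : 'I_3))).
- by apply/rowP => b; rewrite !mxE inordK// /xcoord /= !mxE mul1r.
- apply/matrixP => b c; rewrite !mxE.
  by case: b => -[|[|[|?]]] ?; rewrite //= /bump /= inordK.
- apply/matrixP => b c; rewrite !mxE.
  by case: b => -[|[|[|?]]] ?; rewrite //= /bump /= inordK.
Qed.

Lemma crossP X Y Z : dot (cross X Y) Z = varphi X Y Z.
Proof.
have lin a W W' : varphi X Y (a *: W + W') = a * varphi X Y W + varphi X Y W'.
  by rewrite /varphi !e3Z !mulrDr !mulrN; ring.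
have v0 : varphi X Y 0 = 0.
  by have /eqP := lin 1 0 0; rewrite scaler0 add0r mul1r -subr_eq subrr => /eqP.
rewrite [Z in RHS]row_sum_delta /dot.
under eq_bigr do rewrite mxE mulrC.
elim/big_rec2: _ => [|k a W _ ->]; first by rewrite v0.
by rewrite lin.
Qed.

Lemma cross_unique (P : 'rV[R]_7 -> 'rV[R]_7 -> 'rV[R]_7) :
  (forall X Y Z, dot (P X Y) Z = varphi X Y Z) -> P = cross.
Proof.
move=> PE; apply/funext => X; apply/funext => Y; apply/rowP => k.
rewrite [RHS]mxE -PE /dot (bigD1 k)//= big1 ?addr0 => [|i ik].
  by rewrite mxE !eqxx mulr1.
by rewrite mxE (negPf ik) mulr0.
Qed.

End cross_product.

Section orbit_spaces.
Context {R : realType}.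

Lemma act7_1 (p : 'rV[R]_7) : act7 1%:M p = p.
Proof.
rewrite /act7 mul1mx; apply/rowP => -[[|[|[|[|[|[|[|k]]]]]]] lk7] //.
all: rewrite !mxE/= ?mxE ?inordK //= /tcoord /xcoord; congr (p _ _).
all: by apply/val_inj; rewrite /= inordK.
Qed.

Lemma of_ztK (z : 'cV[R[i]]_3) t : zcoord (of_zt z t) = z.
Proof.
apply/colP => -[[|[|[|k]]] lk3] //; rewrite mxE/= /xcoord !mxE !inordK//=.
all: rewrite [X in z X _](_ : _ = Ordinal lk3).
all: try by apply/val_inj; rewrite /= inordK.
all: by case: (z _ _).
Qed.

Lemma tcoord_of_zt (z : 'cV[R[i]]_3) (t : R) : tcoord (of_zt z t) = t.
Proof. by rewrite /tcoord /xcoord mxE inordK. Qed.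

Lemma act7M (A B : 'M[R[i]]_3) (p : 'rV[R]_7) :
  act7 (A *m B) p = act7 A (act7 B p).
Proof. by rewrite /act7 of_ztK tcoord_of_zt mulmxA. Qed.

Lemma expiD (s t : R) : expi (s + t) = expi s * expi t.
Proof.
rewrite /expi cosD sinD; congr Complex; exact: addrC.
Qed.

Lemma torus_mxM (a b c d : R) :
  torus_mx a b *m torus_mx c d = torus_mx (a + c) (b + d).
Proof. by rewrite diag3M -!expiD -opprD addrACA. Qed.

Lemma torus_mx0 : torus_mx 0 0 = 1%:M :> 'M[R[i]]_3.
Proof. by rewrite /torus_mx addr0 oppr0 /expi cos0 sin0 -diag3_1. Qed.

Lemma T2_equiv_subproof :
  equiv_class_of (orbit_rel act7 T2 (nu_S6_zero R)).
Proof.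
apply: orbit_rel_equiv; [exact: act7_1|exact: act7M| | |].
- by exists 0, 0; rewrite torus_mx0.
- by move=> _ _ [a [b ->]] [c [d ->]]; exists (a + c), (b + d); rewrite torus_mxM.
- move=> _ [a [b ->]]; exists (torus_mx (- a) (- b)); first by exists (- a), (- b).
  by rewrite torus_mxM !addNr torus_mx0.
Qed.

Lemma act4_1 (v : 'rV[R]_4) : act4 1%:M v = v.
Proof. by rewrite /act4 mul1mx trmxK hsubmxK. Qed.

Lemma act4M (E F : 'M[R]_3) (v : 'rV[R]_4) :
  act4 (E *m F) v = act4 E (act4 F v).
Proof. by rewrite /act4 row_mxKl row_mxKr trmxK mulmxA. Qed.

Lemma Z22_equiv_subproof :
  equiv_class_of (orbit_rel act4 Z22 (unit_sphere R 4)).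
Proof.
have pm1 (a b : R) : a \in [:: 1; -1] -> b \in [:: 1; -1] ->
    a * b \in [:: 1; -1].
  rewrite !inE => /orP[]/eqP-> /orP[]/eqP->;
    by rewrite ?mul1r ?mulN1r ?opprK ?eqxx ?orbT.
have sq1 (a : R) : a \in [:: 1; -1] -> a * a = 1.
  by rewrite !inE => /orP[]/eqP->; rewrite ?mul1r ?mulN1r ?opprK.
apply: orbit_rel_equiv; [exact: act4_1|exact: act4M| | |].
- by exists 1, 1; rewrite !inE eqxx mul1r diag3_1.
- move=> _ _ [a [b [a1 b1 ->]]] [c [d [c1 d1 ->]]].
  exists (a * c), (b * d); split; [exact: pm1|exact: pm1|].
  by rewrite diag3M mulrACA.
- move=> _ [a [b [a1 b1 ->]]]; exists (diag3 a b (a * b)); first by exists a, b.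
  by rewrite diag3M !sq1 ?pm1 // diag3_1.
Qed.

End orbit_spaces.

Definition T2_equiv (R : realType) : equiv_rel (nu_S6_zero R) :=
  EquivRelPack (@T2_equiv_subproof R).

Definition Z22_equiv (R : realType) : equiv_rel (unit_sphere R 4) :=
  EquivRelPack (@Z22_equiv_subproof R).

Definition nu_S6_zero_mod_T2 (R : realType) : topologicalType :=
  quotient_topology {eq_quot T2_equiv R}.

Definition S3_mod_Z22 (R : realType) : topologicalType :=
  quotient_topology {eq_quot Z22_equiv R}.

(* Main.v *)
(* On the slice z = (i y_1, y_2, y_3) the product z_1 z_2 z_3 is imaginary, so
   nu vanishes there. Conversely, rotating the arguments of z_1 and z_2 with the
   torus brings every zero of nu to the slice: either some z_k is zero and its
   argument is free, or the vanishing of Re (z_1 z_2 z_3) puts z_3 on the real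
   axis. The functions |z_1|^2, |z_2|^2, |z_3|^2, Im (z_1 z_2 z_3) and t are
   T^2-invariant, and on the slice they separate the orbits of Z_2^2, so the
   continuous map S^3 / Z_2^2 -> nu^-1(0) / T^2 is bijective, with compact
   source and with target embedded injectively in R^5. *)

Require Import Defs.
From mathcomp Require Import all_boot all_order all_algebra.
From mathcomp Require Import generic_quotient.
From mathcomp Require Import all_classical all_reals all_analysis.
From mathcomp Require Import complex ring lra.

Set Implicit Arguments.
Unset Strict Implicit.
Unset Printing Implicit Defensive.

Import Order.TTheory GRing.Theory Num.Theory.
Import numFieldNormedType.Exports.

Local Open Scope classical_set_scope.
Local Open Scope ring_scope.
Local Open Scope quotient_scope.

(** * General topology: compactness and homeomorphisms *)

(* The composite [h \o f] embeds the compact space [X] in the Hausdorff space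
   [Z], so [f] sends closed sets to preimages under [h] of compact sets. *)
Lemma homeomorphic_separated (X Y Z : topologicalType)
    (f : X -> Y) (h : Y -> Z) :
  compact [set: X] -> hausdorff_space Z -> continuous f -> continuous h ->
  (forall y, exists x, f x = y) -> injective (h \o f) -> homeomorphic Y X.
Proof.
move=> cX hZ cf ch fsurj hfI.
have [g fg] := boolp.choice fsurj; have gf : cancel f g.
  by move=> x; apply: hfI => /=; rewrite fg.
exists g, f; split => //; apply/continuous_closedP => C cC.
have -> : g @^-1` C = h @^-1` ((h \o f) @` C).
  apply/seteqP; split => y /=; first by move=> Cgy; exists (g y); rewrite ?fg.
  move=> [x Cx]; rewrite -[in RHS](fg y) => /hfI <-//.
apply: closed_comp; first by move=> ? _; exact: ch.
apply: compact_closed => //; apply: continuous_compact.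
  apply: continuous_subspaceT => x.
  by apply: continuous_comp; [exact: cf|exact: ch].
exact: (subclosed_compact cC cX).
Qed.

(** A filter on the subtype is pushed forward along [set_val]; its cluster point in [A] lifts
    because opens of the subtype are traces of opens of [X]. *)
Lemma compact_set_type (X : topologicalType) (A : set X) :
  compact A -> compact [set: A].
Proof.
move=> cA F FF _.
have [|p [Ap clp]] := cA (set_val @ F) _.
  by apply: nearW => x; exact: set_valP.
exists (SigSub (mem_set Ap)); split=> // B C FB.
rewrite nbhsE => -[_ [[U oU <-] Up] UC].
have nU := open_nbhs_nbhs (conj oU Up).
have [|_ [[x Bx <-] Ux]] := clp (set_val @` B) U _ nU.
  by rewrite nbhs_simpl /=; apply: filterS FB => x Bx; exists x.
by exists x; split=> //; apply: UC.
Qed.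

(** * Continuity and compactness for real row vectors *)

Section coordinates.
Context {R : realType}.

Lemma continuous_row (T : topologicalType) n (f : 'I_n -> T -> R) :
  (forall k, continuous (f k)) -> continuous (fun x => \row_k f k x).
Proof.
move=> cf x A [P fxP PA]; rewrite nbhs_simpl /=.
have : \forall y \near x, forall k, P 0 k (f k y).
  apply: filter_forall => k; apply: (cf k x).
  by have := fxP 0 k; rewrite mxE.
by apply: filterS => y Py; apply: PA => i k; rewrite ord1 mxE.
Qed.

Lemma continuous_dot n : continuous (fun v : 'rV[R]_n => dot v v).
Proof.
apply: (continuous_big add_continuous) => k _ v.
by apply: (@continuousM _ _ (fun w : 'rV[R]_n => w 0 k)
  (fun w : 'rV[R]_n => w 0 k)); exact: coord_continuous.
Qed.

(** The sphere is closed and lies in the compact cube [-1, 1]^n. *)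
Lemma compact_unit_sphere n : compact (unit_sphere R n).
Proof.
have cube :
    compact [set v : 'rV[R]_n | forall i, `[(-1), 1]%classic (v ord0 i)].
  apply (@rV_compact R n (fun=> `[(-1), 1]%classic)) => _.
  exact: segment_compact.
have closedS : closed (unit_sphere R n).
  rewrite (_ : unit_sphere R n = (fun v => dot v v) @^-1` [set 1]) //.
  by apply: closed_comp => [v _|]; [exact: continuous_dot|exact: closed_eq].
apply: (subclosed_compact closedS cube) => v /= v1 i.
rewrite in_itv /= -ler_norml -(@ler_pXn2r _ 2) ?nnegrE//.
rewrite expr1n real_normK ?num_real// -v1 /dot (bigD1 i)//= -expr2 lerDl.
by apply: sumr_ge0 => k _; rewrite -expr2 sqr_ge0.
Qed.

End coordinates.

(** * The torus action in coordinates and the formula for [nu_S6] *)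

Lemma det3 (K : comPzRingType) (A : 'M[K]_3)
    (a := fun i j : nat => A (inord i) (inord j)) :
  \det A = a 0 0 * (a 1 1 * a 2 2 - a 1 2 * a 2 1)
         - a 0 1 * (a 1 0 * a 2 2 - a 1 2 * a 2 0)
         + a 0 2 * (a 1 0 * a 2 1 - a 1 1 * a 2 0).
Proof.
have aE i j : A i j = a i j by rewrite /a !inord_val.
rewrite (expand_det_row _ ord0) !big_ord_recl big_ord0 /cofactor.
rewrite !(expand_det_row _ ord0) !big_ord_recl !big_ord0 /cofactor.
rewrite !det_mx11 !mxE.
rewrite !aE /= /bump /=.
ring.
Qed.

Section torus_action.
Context {R : realType}.
Implicit Types (p : 'rV[R]_7) (s a b t : R) (z : R[i]).

Definition row7 (x1 x2 x3 x4 x5 x6 x7 : R) : 'rV[R]_7 :=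
  \row_(k < 7) [:: x1; x2; x3; x4; x5; x6; x7]`_k.

Lemma row7E p : p = row7 (xcoord 1 p) (xcoord 2 p) (xcoord 3 p) (xcoord 4 p)
  (xcoord 5 p) (xcoord 6 p) (xcoord 7 p).
Proof.
apply/rowP => -[[|[|[|[|[|[|[|k]]]]]]] lk] //; rewrite mxE /xcoord /=.
all: by congr (p _ _); apply/val_inj; rewrite /= inordK.
Qed.

Lemma row7_coord (x1 x2 x3 x4 x5 x6 x7 : R) (k : nat) : (k < 7)%N ->
  row7 x1 x2 x3 x4 x5 x6 x7 0 (inord k) = [:: x1; x2; x3; x4; x5; x6; x7]`_k.
Proof. by move=> k7; rewrite mxE inordK. Qed.

Lemma act7_torus a b (x1 x2 x3 x4 x5 x6 x7 : R) :
  act7 (torus_mx a b) (row7 x1 x2 x3 x4 x5 x6 x7) =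
  row7 (cos a * x1 - sin a * x6) (cos b * x2 + sin b * x5)
       (cos (a + b) * x3 - sin (a + b) * x4)
       (cos (a + b) * x4 + sin (a + b) * x3)
       (cos b * x5 - sin b * x2) (cos a * x6 + sin a * x1) x7.
Proof.
rewrite /act7 /torus_mx /diag3 mul_diag_mx.
apply/rowP => -[[|[|[|[|[|[|[|k]]]]]]] lk] //; rewrite !mxE /=.
all: rewrite /tcoord /xcoord ?mxE ?inordK //= ?row7_coord //= ?cosN ?sinN; ring.
Qed.

(** Each circle factor of the torus moves a point along a curve of this form, with [C] the part that
    it fixes. *)
Lemma derive1_rot (A B C : 'rV[R]_7) :
  derive1 (fun s : R => cos s *: A + sin s *: B + C) 0 = B.
Proof.
have dk k : is_derive (0 : R) 1
    (fun s : R => (cos s *: A + sin s *: B + C) 0 k) (B 0 k).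
  rewrite (_ : (fun s => _) =
    (cos * cst (A 0 k)) + (sin * cst (B 0 k)) + cst (C 0 k)); last first.
    by apply/funext => s; rewrite !mxE.
  apply: is_derive_eq.
  by rewrite cos0 sin0 /GRing.scale /=; ring.
rewrite derive1E derive_mx.
  by apply/rowP => k; rewrite mxE; have [_ ->] := dk k.
by apply/derivable_mxP => i k; rewrite ord1; have [] := dk k.
Qed.

Lemma gen_UE (x1 x2 x3 x4 x5 x6 x7 : R) :
  gen_U (row7 x1 x2 x3 x4 x5 x6 x7) = row7 (- x6) 0 (- x4) x3 0 x1 0.
Proof.
(* The first circle fixes z_2 and t, which make up the constant term. *)
rewrite -[RHS](derive1_rot (row7 x1 0 x3 x4 0 x6 0) _ (row7 0 x2 0 0 x5 0 x7)).
congr (derive1 _ 0); apply/funext => s; rewrite act7_torus addr0 cos0 sin0.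
apply/rowP => -[[|[|[|[|[|[|[|k]]]]]]] lk] //; rewrite !mxE /=; ring.
Qed.

Lemma gen_VE (x1 x2 x3 x4 x5 x6 x7 : R) :
  gen_V (row7 x1 x2 x3 x4 x5 x6 x7) = row7 0 x5 (- x4) x3 (- x2) 0 0.
Proof.
rewrite -[RHS](derive1_rot (row7 0 x2 x3 x4 x5 0 0) _ (row7 x1 0 0 0 0 x6 x7)).
congr (derive1 _ 0); apply/funext => s; rewrite act7_torus add0r cos0 sin0.
apply/rowP => -[[|[|[|[|[|[|[|k]]]]]]] lk] //; rewrite !mxE /=; ring.
Qed.

(** By [crossP] the left side is varphi(p, U, V), a polynomial in the coordinates. *)
Lemma nu_S6E (x1 x2 x3 x4 x5 x6 x7 : R) :
  nu_S6 (row7 x1 x2 x3 x4 x5 x6 x7) =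
  3 * complex.Re (Complex x1 x6 * Complex x5 x2 * Complex x4 x3).
Proof.
rewrite /nu_S6 /sigma_S6 /J_S6 /unit_normal crossP gen_UE gen_VE.
rewrite /varphi /e3 !det3 !mxE !inordK //= /xcoord /= !row7_coord //=.
ring.
Qed.

End torus_action.

(** * The slice, the invariants and the normal form of an orbit *)

Section normal_form.
Context {R : realType}.
Implicit Types (p q : 'rV[R]_7) (a b t r : R) (z : R[i]).

Lemma polar z : exists a r, z = Complex (r * cos a) (r * sin a).
Proof.
case: z => x y; have [r0|r0] := eqVneq (x ^+ 2 + y ^+ 2) 0.
  exists 0, 0; move/eqP: r0; rewrite paddr_eq0 ?sqr_ge0// !sqrf_eq0.
  by move=> /andP[/eqP-> /eqP->]; rewrite !mul0r.
set r := Num.sqrt (x ^+ 2 + y ^+ 2).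
have rE : r ^+ 2 = x ^+ 2 + y ^+ 2 by rewrite sqr_sqrtr// addr_ge0 ?sqr_ge0.
have r_gt0 : 0 < r by rewrite sqrtr_gt0 lt_neqAle eq_sym r0 addr_ge0 ?sqr_ge0.
have xr : -1 <= x / r <= 1.
  rewrite -ler_norml -(@ler_pXn2r _ 2) ?nnegrE// expr1n real_normK ?num_real//.
  by rewrite expr_div_n rE ler_pdivrMr ?mul1r ?lerDl ?sqr_ge0// -rE exprn_gt0.
have cE : r * cos (acos (x / r)) = x.
  by rewrite acosK ?in_itv// mulrC divfK ?gt_eqF.
have sE : (r * sin (acos (x / r))) ^+ 2 = y ^+ 2.
  by rewrite exprMn sin2cos2 mulrBr mulr1 -exprMn cE rE; ring.
(* [acos] fixes the cosine and leaves the sign of the sine open; the opposite angle serves the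
   second sign. *)
move/eqP: sE; rewrite eqf_sqr => /orP[]/eqP sE.
- by exists (acos (x / r)), r; rewrite cE sE.
- by exists (- acos (x / r)), r; rewrite cosN sinN cE mulrN sE opprK.
Qed.

(* [(y, t)] goes to [(z_1, z_2, z_3) = (i y_1, y_2, y_3)]. *)
Definition slice (v : 'rV[R]_4) : 'rV[R]_7 :=
  row7 0 0 0 (v 0 (inord 2)) (v 0 (inord 1)) (v 0 (inord 0)) (v 0 (inord 3)).

Definition row4 (y1 y2 y3 t : R) : 'rV[R]_4 :=
  \row_(k < 4) [:: y1; y2; y3; t]`_k.

Lemma row4E (v : 'rV[R]_4) :
  v = row4 (v 0 (inord 0)) (v 0 (inord 1)) (v 0 (inord 2)) (v 0 (inord 3)).
Proof.
apply/rowP => -[[|[|[|[|k]]]] lk] //; rewrite mxE /=.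
all: by congr (v _ _); apply/val_inj; rewrite /= inordK.
Qed.

Lemma dot_row4 (y1 y2 y3 t : R) :
  dot (row4 y1 y2 y3 t) (row4 y1 y2 y3 t) =
  y1 ^+ 2 + y2 ^+ 2 + y3 ^+ 2 + t ^+ 2.
Proof. rewrite /dot !big_ord_recl big_ord0 !mxE /=; ring. Qed.

Lemma dot_row7 (x1 x2 x3 x4 x5 x6 x7 : R) :
  dot (row7 x1 x2 x3 x4 x5 x6 x7) (row7 x1 x2 x3 x4 x5 x6 x7) =
  x1 ^+ 2 + x2 ^+ 2 + x3 ^+ 2 + x4 ^+ 2 + x5 ^+ 2 + x6 ^+ 2 + x7 ^+ 2.
Proof. rewrite /dot !big_ord_recl big_ord0 !mxE /=; ring. Qed.

Lemma slice_row4 (y1 y2 y3 t : R) :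
  slice (row4 y1 y2 y3 t) = row7 0 0 0 y3 y2 y1 t.
Proof. by rewrite /slice !mxE !inordK. Qed.

Lemma slice_nu_zero (v : 'rV[R]_4) :
  unit_sphere R 4 v -> nu_S6_zero R (slice v).
Proof.
rewrite (row4E v) slice_row4 /unit_sphere /= dot_row4 => v1; split => /=.
  rewrite /unit_sphere /= dot_row7 -v1; ring.
by rewrite nu_S6E /=; ring.
Qed.

Lemma act4_diag3 (e1 e2 e3 y1 y2 y3 t : R) :
  act4 (diag3 e1 e2 e3) (row4 y1 y2 y3 t) =
  row4 (e1 * y1) (e2 * y2) (e3 * y3) t.
Proof.
rewrite /act4 /diag3 mul_diag_mx; apply/rowP => k; rewrite [LHS]mxE [RHS]mxE.
case: splitP => -[j lj] /= ->; rewrite !mxE /=.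
  by case: j lj => [|[|[|]]] //= _; rewrite ?mxE.
by case: j lj => [|] //= _; rewrite ?mxE.
Qed.

(** The signs are the values of e^(ia) at the angles 0 and pi; this places [Z22] inside [T2]. *)
Lemma sign_cos_sin (e : R) : e \in [:: 1; -1] -> exists a, cos a = e /\ sin a = 0.
Proof.
rewrite !inE => /orP[]/eqP->.
- by exists 0; rewrite cos0 sin0.
- by exists pi; rewrite cospi sinpi.
Qed.

Definition invariants p : 'rV[R]_5 :=
  \row_(k < 5) [:: xcoord 1 p ^+ 2 + xcoord 6 p ^+ 2;
     xcoord 5 p ^+ 2 + xcoord 2 p ^+ 2; xcoord 4 p ^+ 2 + xcoord 3 p ^+ 2;
     complex.Im (Complex (xcoord 1 p) (xcoord 6 p) *
       Complex (xcoord 5 p) (xcoord 2 p) * Complex (xcoord 4 p) (xcoord 3 p));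
     xcoord 7 p]`_k.

Lemma invariants_row7 (x1 x2 x3 x4 x5 x6 x7 : R) :
  invariants (row7 x1 x2 x3 x4 x5 x6 x7) =
  \row_(k < 5) [:: x1 ^+ 2 + x6 ^+ 2; x5 ^+ 2 + x2 ^+ 2; x4 ^+ 2 + x3 ^+ 2;
    complex.Im (Complex x1 x6 * Complex x5 x2 * Complex x4 x3); x7]`_k.
Proof. by rewrite /invariants /xcoord !row7_coord. Qed.

Lemma invariants_act7 a b p :
  invariants (act7 (torus_mx a b) p) = invariants p.
Proof.
rewrite (row7E p) act7_torus !invariants_row7.
move: (xcoord 1 p) (xcoord 2 p) (xcoord 3 p).
move: (xcoord 4 p) (xcoord 5 p) (xcoord 6 p).
move=> x4 x5 x6 x1 x2 x3.
have rot (c x y : R) :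
    (cos c * x - sin c * y) ^+ 2 + (cos c * y + sin c * x) ^+ 2 = x ^+ 2 + y ^+ 2.
  transitivity ((cos c ^+ 2 + sin c ^+ 2) * (x ^+ 2 + y ^+ 2)); first by ring.
  by rewrite cos2Dsin2 mul1r.
apply/rowP => -[[|[|[|[|[|k]]]]] lk] //; rewrite !mxE /=.
- exact: rot.
- exact: rot.
(* z_3 = x4 + i x3 turns by -(a + b), so it is the swapped pair (x3, x4) that turns by a + b. *)
- by rewrite addrC [RHS]addrC -[RHS](rot (a + b)) addrC.
(* The three angles sum to zero, so after expansion only the Pythagorean factors of a and b
   remain. *)
- rewrite cosD sinD; transitivity ((cos a ^+ 2 + sin a ^+ 2) *
    (cos b ^+ 2 + sin b ^+ 2) *
    complex.Im (Complex x1 x6 * Complex x5 x2 * Complex x4 x3)).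
    by simpl; ring.
  by rewrite !cos2Dsin2 !mul1r.
- by [].
Qed.

Lemma slice_orbit (v w : 'rV[R]_4) E : Z22 E -> act4 E v = w ->
  exists2 A, T2 A & act7 A (slice v) = slice w.
Proof.
move=> [e1 [e2 [/sign_cos_sin[a [ca sa]] /sign_cos_sin[b [cb sb]] ->]]] <-.
exists (torus_mx a b); first by exists a, b.
rewrite (row4E v) act4_diag3 !slice_row4 act7_torus cosD sinD ca sa cb sb.
by congr row7; ring.
Qed.

(* If no [y_k] vanishes the three signs multiply to 1; otherwise the sign in
   front of a vanishing [y_k] can be chosen freely. *)
Lemma signs_of_squares (x1 x2 x3 y1 y2 y3 : R) :
  x1 ^+ 2 = y1 ^+ 2 -> x2 ^+ 2 = y2 ^+ 2 -> x3 ^+ 2 = y3 ^+ 2 ->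
  x1 * x2 * x3 = y1 * y2 * y3 ->
  exists e1 e2, [/\ e1 \in [:: 1; -1], e2 \in [:: 1; -1] &
    [/\ e1 * x1 = y1, e2 * x2 = y2 & e1 * e2 * x3 = y3]].
Proof.
have sgn x y : x ^+ 2 = y ^+ 2 -> exists2 e : R, e \in [:: 1; -1] & e * x = y.
  move=> /eqP; rewrite eqf_sqr => /orP[]/eqP->.
    by exists 1; rewrite ?inE ?eqxx ?mul1r.
  by exists (-1); rewrite ?inE ?eqxx ?orbT// mulN1r opprK.
have pm1 (a b : R) : a \in [:: 1; -1] -> b \in [:: 1; -1] ->
    a * b \in [:: 1; -1].
  rewrite !inE => /orP[]/eqP-> /orP[]/eqP->;
    by rewrite ?mul1r ?mulN1r ?opprK ?eqxx ?orbT.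
have sq1 (a : R) : a \in [:: 1; -1] -> a * a = 1.
  by rewrite !inE => /orP[]/eqP->; rewrite ?mul1r ?mulN1r ?opprK.
move=> /sgn[e1 e1P <-] /sgn[e2 e2P <-] /sgn[e3 e3P <-] prodE.
have [x10|x1n0] := eqVneq x1 0.
  exists (e2 * e3), e2; split; [exact: pm1|by []|].
  by rewrite x10 !mulr0 [e2 * e3 * e2]mulrAC sq1// mul1r.
have [x20|x2n0] := eqVneq x2 0.
  exists e1, (e1 * e3); split; [by []|exact: pm1|].
  by rewrite x20 !mulr0 mulrA sq1// mul1r.
have [x30|x3n0] := eqVneq x3 0.
  by exists e1, e2; rewrite x30 !mulr0.
exists e1, e2; split => //; split => //; congr (_ * _).
have : e1 * e2 * e3 * (x1 * x2 * x3) = 1 * (x1 * x2 * x3).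
  by rewrite mul1r [RHS]prodE; ring.
move=> /mulIf; rewrite !mulf_neq0// => /(_ isT) e123.
by rewrite -[RHS]mul1r -e123 -mulrA sq1 ?mulr1.
Qed.

(** On the slice the invariants are the y_k^2, the product y_1 y_2 y_3 and t, which is the input of
    [signs_of_squares]. *)
Lemma invariants_slice_inj (v w : 'rV[R]_4) :
  invariants (slice v) = invariants (slice w) ->
  exists2 E, Z22 E & act4 E v = w.
Proof.
rewrite (row4E v) (row4E w) !slice_row4 !invariants_row7 => /rowP eqvw.
have := eqvw (inord 0); have := eqvw (inord 1); have := eqvw (inord 2).
have := eqvw (inord 3); have := eqvw (inord 4); rewrite !mxE !inordK//=.
move=> -> y123; rewrite !expr0n !add0r !addr0 => y3 y2 y1.
have [|e1 [e2 [e1P e2P [<- <- <-]]]] := signs_of_squares y1 y2 y3.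
  by lra.
by exists (diag3 e1 e2 (e1 * e2)); [exists e1, e2|rewrite act4_diag3].
Qed.

Lemma slice_onto p : nu_S6_zero R p ->
  exists2 v, unit_sphere R 4 v & exists2 A, T2 A & act7 A (slice v) = p.
Proof.
rewrite (row7E p).
move: (xcoord 1 p) (xcoord 2 p) (xcoord 3 p) (xcoord 4 p).
move: (xcoord 5 p) (xcoord 6 p) (xcoord 7 p) => x5 x6 t x1 x2 x3 x4 [].
rewrite /unit_sphere /= dot_row7 nu_S6E => p1 nu0.
(* These equations say that z_1 = i y1 e^(ia), z_2 = y2 e^(ib) and z_3 = y3 e^(-i(a+b)). *)
suff [a [b [y1 [y2 [y3 [[h1 h6] [h2 h5] [h3 h4]]]]]]] : exists a b y1 y2 y3,
    [/\ x1 = - (y1 * sin a) /\ x6 = y1 * cos a,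
        x2 = y2 * sin b /\ x5 = y2 * cos b &
        x3 = - (y3 * sin (a + b)) /\ x4 = y3 * cos (a + b)].
  exists (row4 y1 y2 y3 t).
    rewrite dot_row4 -p1 h1 h2 h3 h4 h5 h6.
    transitivity (y1 ^+ 2 * (cos a ^+ 2 + sin a ^+ 2) +
      y2 ^+ 2 * (cos b ^+ 2 + sin b ^+ 2) +
      y3 ^+ 2 * (cos (a + b) ^+ 2 + sin (a + b) ^+ 2) + t ^+ 2); last by ring.
    by rewrite !cos2Dsin2 !mulr1.
  exists (torus_mx a b); first by exists a, b.
  rewrite slice_row4 act7_torus h1 h2 h3 h4 h5 h6.
  by congr row7; ring.
(* Polar forms of z_1 / i, z_2 and the conjugate of z_3, so that the angles match those of the
   slice; the aim is c = a + b. *)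
have [a [r1 [h6 h1]]] := polar (Complex x6 (- x1)).
have [b [r2 [h5 h2]]] := polar (Complex x5 x2).
have [c [r3 [h4 h3]]] := polar (Complex x4 (- x3)).
move: h1 h3 => /eqP; rewrite eqr_oppLR => /eqP h1 /eqP.
rewrite eqr_oppLR => /eqP h3.
have [r10|r1n0] := eqVneq r1 0.
  (* When z_1 = 0 its angle is free and is chosen to make a + b = c; likewise below for z_2. *)
  exists (c - b), b, 0, r2, r3; rewrite subrK !mul0r oppr0.
  by rewrite h1 h6 r10 !mul0r oppr0.
have [r20|r2n0] := eqVneq r2 0.
  exists a, (c - a), r1, 0, r3; rewrite [a + _]addrC subrK !mul0r.
  by rewrite h2 h5 r20 !mul0r.
(* Here z_1 z_2 z_3 = i r1 r2 r3 e^(i(a+b-c)), whose real part is -r1 r2 r3 sin(a+b-c). *)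
have rsin0 : r3 * sin (a + b - c) = 0.
  have : (3 * r1 * r2) * (r3 * sin (a + b - c)) = 0.
    by rewrite -[RHS]oppr0 -nu0 h1 h2 h3 h4 h5 h6 sinB cosD sinD /=; ring.
  by move/eqP; rewrite mulf_eq0 !mulf_eq0 (negPf r1n0) (negPf r2n0) pnatr_eq0
    /= => /orP[]/eqP->; rewrite ?mul0r ?mulr0.
(* Since r3 sin d = 0, the factor r3 e^(id) equals the real number r3 cos d; this treats r3 = 0 and
   sin d = 0 at once. *)
set d := a + b - c in rsin0; have cE : c = a + b - d by rewrite /d; ring.
exists a, b, r1, r2, (r3 * cos d); split=> //.
rewrite h3 h4 cE sinB cosB; split.
  transitivity (- (r3 * cos d * sin (a + b)) + cos (a + b) * (r3 * sin d)).
    by ring.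
  by rewrite rsin0 mulr0 addr0.
transitivity (r3 * cos d * cos (a + b) + sin (a + b) * (r3 * sin d)).
  by ring.
by rewrite rsin0 mulr0 addr0.
Qed.

End normal_form.

(** * Continuity of the maps and passage to the orbit spaces *)

Section quotients.
Context {R : realType}.

Lemma continuous_slice : continuous (@slice R).
Proof.
apply: continuous_row => -[[|[|[|[|[|[|[|k]]]]]]] lk] //=.
all: first [exact: coord_continuous | exact: cst_continuous].
Qed.

Lemma continuous_invariants : continuous (@invariants R).
Proof.
have cx i : continuous (fun p : 'rV[R]_7 => xcoord i p).
  exact: coord_continuous.
have cD (f g : 'rV[R]_7 -> R) :
    continuous f -> continuous g -> continuous (fun p => f p + g p).
  by move=> cf cg p; apply: (@continuousD _ _ _ f g); [exact: cf|exact: cg].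
have cN (f : 'rV[R]_7 -> R) : continuous f -> continuous (fun p => - f p).
  by move=> cf p; apply: (@continuousN _ _ _ f); exact: cf.
have cM (f g : 'rV[R]_7 -> R) :
    continuous f -> continuous g -> continuous (fun p => f p * g p).
  by move=> cf cg p; apply: (@continuousM _ _ f g); [exact: cf|exact: cg].
apply: continuous_row => -[[|[|[|[|[|k]]]]] lk] //=.
- by apply: (cD _ _ (cM _ _ _ _) (cM _ _ _ _)).
- by apply: (cD _ _ (cM _ _ _ _) (cM _ _ _ _)).
- by apply: (cD _ _ (cM _ _ _ _) (cM _ _ _ _)).
- by apply: (cD _ _ (cM _ _ (cD _ _ (cM _ _ _ _) (cN _ (cM _ _ _ _))) _)
    (cM _ _ (cD _ _ (cM _ _ _ _) (cM _ _ _ _)) _)).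
Qed.

End quotients.

Lemma T2_piP (R : realType) (p q : nu_S6_zero R) :
  \pi_(nu_S6_zero_mod_T2 R) p = \pi_(nu_S6_zero_mod_T2 R) q <->
  exists2 A, T2 A & act7 A (\val p) = \val q.
Proof.
split; first by move=> /(@eqmodP _ (T2_equiv R)) /asboolP.
by move=> Apq; apply/(@eqmodP _ (T2_equiv R))/asboolP.
Qed.

Lemma Z22_piP (R : realType) (v w : unit_sphere R 4) :
  \pi_(S3_mod_Z22 R) v = \pi_(S3_mod_Z22 R) w <->
  exists2 E, Z22 E & act4 E (\val v) = \val w.
Proof.
split; first by move=> /(@eqmodP _ (Z22_equiv R)) /asboolP.
by move=> Apq; apply/(@eqmodP _ (Z22_equiv R))/asboolP.
Qed.

Theorem proposition3p2 (R : realType) :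
  homeomorphic (nu_S6_zero_mod_T2 R) (S3_mod_Z22 R).
Proof.
pose j (v : unit_sphere R 4) : nu_S6_zero R :=
  SigSub (mem_set (slice_nu_zero (set_valP v))).
have cj : continuous j.
  apply: continuous_comp_initial => v.
  apply: (@continuous_comp _ _ _ set_val (@slice R)).
    exact: initial_continuous.
  exact: continuous_slice.
pose inv (p : nu_S6_zero R) := invariants (set_val p).
have cinv : continuous inv.
  move=> p; apply: continuous_comp; first exact: initial_continuous.
  exact: continuous_invariants.
have invE (p q : nu_S6_zero R) :
    \pi_(nu_S6_zero_mod_T2 R) p = \pi_(nu_S6_zero_mod_T2 R) q -> inv p = inv q.
  move=> /T2_piP[_ [a [b ->]]]; rewrite /inv set_valE => <-.
  by rewrite invariants_act7.
have piE (v w : unit_sphere R 4) :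
    \pi_(S3_mod_Z22 R) v = \pi_(S3_mod_Z22 R) w ->
    \pi_(nu_S6_zero_mod_T2 R) (j v) = \pi_(nu_S6_zero_mod_T2 R) (j w).
  by move=> /Z22_piP[E ZE vw]; apply/T2_piP; exact: slice_orbit ZE vw.
(* Both maps go through an arbitrary representative; [piE] and [invE] make them independent of that
   choice, hence continuous on the quotients. *)
pose f : S3_mod_Z22 R -> nu_S6_zero_mod_T2 R :=
  \pi_(nu_S6_zero_mod_T2 R) \o j \o repr.
pose h : nu_S6_zero_mod_T2 R -> 'rV[R]_5 := inv \o repr.
apply: (@homeomorphic_separated _ _ _ f h).
(* The source is compact as the image of the sphere under the projection. *)
- rewrite (_ : setT = \pi_(S3_mod_Z22 R) @` setT).
    apply: continuous_compact.
      by apply: continuous_subspaceT; exact: pi_continuous.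
    exact/compact_set_type/compact_unit_sphere.
  by apply/seteqP; split=> // y _; exists (repr y); rewrite ?reprK.
- exact: norm_hausdorff.
- apply: repr_comp_continuous => [v|v w /eqP/piE/eqP//].
  by apply: continuous_comp; [exact: cj|exact: pi_continuous].
- by apply: repr_comp_continuous => [//|p q /eqP/invE/eqP].
- move=> y; rewrite -[y]reprK; have [v v1 vy] := slice_onto (set_valP (repr y)).
  exists (\pi_(S3_mod_Z22 R) (SigSub (mem_set v1))) => /=.
  transitivity (\pi_(nu_S6_zero_mod_T2 R) (j (SigSub (mem_set v1)))).
    by apply: piE; rewrite reprK.
  exact/T2_piP.
- move=> v w /= e; rewrite -[v]reprK -[w]reprK; apply/Z22_piP.
  (* The equality [e] involves chosen representatives in the target; [invK] removes them. *)
  apply: invariants_slice_inj.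
  have invK p : inv (repr (\pi_(nu_S6_zero_mod_T2 R) p)) = inv p.
    by apply: invE; rewrite reprK.
  by move: e; rewrite /h /f /= !invK.
Qed.
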